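(* Let $A$ be a type A magic square of even order. Then $\det(A)=0$.
   Context: Let $e_1,\dots,e_n$ be the standard basis column vectors of $\mathbb{R}^n$, $e\in\mathbb{R}^n$ the all-ones column vector, $E=ee^T$ the all-ones $n\times n$ matrix, and $J$ the $n\times n$ reverse matrix, with $J_{i,j}=1$ if $i+j=n+1$ and $J_{i,j}=0$ otherwise. A magic square of order $n$ with magic number $\mu$ is a real $n\times n$ matrix $A$ with $e_i^TAe=\mu$ for all $i$, $e^TAe_j=\mu$ for all $j$, $\operatorname{tr}(A)=\mu$ and $\operatorname{tr}(JA)=\mu$. A magic classifying permutation matrix (MCPM) of order $n$ is a symmetric $n\times n$ permutation matrix $P$ such that: if $n$ is even then $\operatorname{tr}(P)=0$; if $n$ is odd then the middle (center) entry of $P$ is $1$ and $\operatorname{tr}(P)=1$. A magic square $A$ of order $n$ with magic number $\mu$ is of type $\mathrm{A}_P$, where $P$ is an MCPM of order $n$, if $A+PAP=\frac{2\mu}{n}E$. It is called a type A magic square if it is of type $\mathrm{A}_P$ for some MCPM $P$. *)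

(* Defs.v *)
(* The field of real numbers is an arbitrary [R : realType]. *)
From mathcomp Require Import all_boot all_order all_algebra.
From mathcomp Require Import reals.

Set Implicit Arguments.
Unset Strict Implicit.
Unset Printing Implicit Defensive.

Import GRing.Theory.
Local Open Scope ring_scope.

Definition stdvec (R : realType) (n : nat) (i : 'I_n) : 'cV[R]_n :=
  delta_mx i 0.

Definition onesvec (R : realType) (n : nat) : 'cV[R]_n := const_mx 1.

Definition onesmx (R : realType) (n : nat) : 'M[R]_n :=
  onesvec R n *m (onesvec R n)^T.

(* Indices start at 0, so the 1-based condition i + j = n + 1 becomes
   i + j + 1 = n. *)
Definition revmx (R : realType) (n : nat) : 'M[R]_n :=
  \matrix_(i < n, j < n) ((i + j).+1 == n)%:R.

(* The products in the row and column conditions are 1 x 1 matrices, read as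
   scalars through their unique entry. *)
Definition magic_square (R : realType) (n : nat) (mu : R) (A : 'M[R]_n) : Prop :=
  [/\ forall i : 'I_n, ((stdvec R i)^T *m A *m onesvec R n) 0 0 = mu,
      forall j : 'I_n, ((onesvec R n)^T *m A *m stdvec R j) 0 0 = mu,
      \tr A = mu
    & \tr (revmx R n *m A) = mu].

(* For odd n the central index, counted from 0, is the i with 2 i + 1 = n. *)
Definition mcpm (R : realType) (n : nat) (P : 'M[R]_n) : Prop :=
  [/\ is_perm_mx P,
      P^T = P,
      ~~ odd n -> \tr P = 0
    & odd n -> (forall i : 'I_n, i.*2.+1 = n -> P i i = 1) /\ \tr P = 1].

Definition of_type_A (R : realType) (n : nat) (mu : R) (P A : 'M[R]_n) : Prop :=
  A + P *m A *m P = (2%:R * mu / n%:R) *: onesmx R n.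

Definition type_A_magic_square (R : realType) (n : nat) (A : 'M[R]_n) : Prop :=
  exists mu : R, magic_square mu A /\
    exists P : 'M[R]_n, mcpm P /\ of_type_A mu P A.

(* Main.v *)
Require Import Defs.
From mathcomp Require Import all_boot all_order all_algebra all_fingroup.
From mathcomp Require Import reals.

(** Let [A] be of type [A_P].  The symmetric permutation matrix [P] is an
involution fixing the all-ones vector [e], and having trace [0] it has
eigenspaces of equal dimension for the eigenvalues [1] and [-1].  Every vector
of the [-1] eigenspace is orthogonal to [e], so on that eigenspace the defining
relation [A + P A P = c E] reads [A P = - P A], and [A] maps it into the [1]
eigenspace ([eigenswap]).  If [A] were invertible, equality of dimensions would
make this map onto; but the row sums of [A] being constant, every vector in its
image is still orthogonal to [e], whereas [e] itself lies in the [1] eigenspace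
and is not orthogonal to itself.

Vectors are row vectors acted on from the right, and the eigenspaces are the
row spaces of the projections [(1 - P) / 2] and [(1 + P) / 2]; their dimensions
come from [mxtrace_idempotent]. *)

Set Implicit Arguments.
Unset Strict Implicit.
Unset Printing Implicit Defensive.

Import GRing.Theory Num.Theory.
Local Open Scope ring_scope.

(** In a rank factorization [Q = C *m B], idempotence cancels to [B *m C = 1],
and the trace does not see the order of the two factors. *)
Lemma mxtrace_idempotent (F : fieldType) (n : nat) (Q : 'M[F]_n) :
  Q *m Q = Q -> \tr Q = (\rank Q)%:R.
Proof.
move=> QQ.
have := (row_base_free Q, col_base_full Q, mulmx_base Q).
move: (row_base Q) (col_base Q) => B C [[freeB fullC] CB].
have BC1 : B *m C = 1%:M.
  apply: (row_free_inj freeB); apply: (row_full_inj fullC).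
  by rewrite mul1mx !mulmxA CB -mulmxA CB.
by rewrite -[in LHS]CB mxtrace_mulC BC1 mxtrace1.
Qed.

Section Involution.

Variables (F : numFieldType) (n : nat).
Implicit Type P : 'M[F]_n.

(** When [P] is an involution these project onto its eigenspaces for [1] and
[-1].  The second is the first for [- P], so that one computation serves both. *)
Definition pos_proj P : 'M[F]_n := 2%:R^-1 *: (1%:M + P).
Definition neg_proj P : 'M[F]_n := pos_proj (- P).

Lemma pos_proj_idempotent P :
  P *m P = 1%:M -> pos_proj P *m pos_proj P = pos_proj P.
Proof.
move=> PP; rewrite /pos_proj -scalemxAl -scalemxAr; congr (_ *: _).
rewrite mulmxDl !mulmxDr !mul1mx mulmx1 PP [P + _]addrC -mulr2n.
by rewrite -scaler_nat scalerA mulVf ?scale1r ?pnatr_eq0.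
Qed.

(** Ranks of projections are traces, and both traces equal [n / 2]. *)
Lemma rank_neg_proj P :
  P *m P = 1%:M -> \tr P = 0 -> \rank (neg_proj P) = \rank (pos_proj P).
Proof.
move=> PP trP; apply/eqP; rewrite -(eqr_nat F) /neg_proj.
have NN : - P *m - P = 1%:M by rewrite mulmxN mulNmx opprK.
rewrite -!mxtrace_idempotent ?pos_proj_idempotent //.
by rewrite /pos_proj !linearZ /= !linearD /= linearN /= trP oppr0.
Qed.

Lemma neg_projP P : P *m P = 1%:M -> neg_proj P *m P = - neg_proj P.
Proof.
move=> PP; rewrite /neg_proj /pos_proj -scalemxAl mulmxDl mul1mx mulNmx PP.
by rewrite -scalerN opprD opprK addrC.
Qed.

Lemma neg_proj_fixed P (v : 'cV[F]_n) : P *m v = v -> neg_proj P *m v = 0.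
Proof.
move=> Pv; rewrite /neg_proj /pos_proj -scalemxAl mulmxDl mul1mx mulNmx Pv.
by rewrite subrr scaler0.
Qed.

Lemma pos_proj_fixed P (v : 'cV[F]_n) : P *m v = v -> pos_proj P *m v = v.
Proof.
move=> Pv; rewrite /pos_proj -scalemxAl mulmxDl mul1mx Pv -mulr2n.
by rewrite -scaler_nat scalerA mulVf ?scale1r ?pnatr_eq0.
Qed.

Lemma sub_pos_proj m P (B : 'M[F]_(m, n)) :
  B *m P = B -> (B <= pos_proj P)%MS.
Proof.
move=> BP; apply/submxP; exists B.
rewrite /pos_proj -scalemxAr mulmxDr mulmx1 BP -mulr2n.
by rewrite -scaler_nat scalerA mulVf ?scale1r ?pnatr_eq0.
Qed.

(** Projecting on the left by [neg_proj P] kills the right-hand side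
[v *m w], which leaves the anticommutation of [A] and [P]. *)
Lemma eigenswap P A (v : 'cV[F]_n) (w : 'rV[F]_n) :
    P *m P = 1%:M -> P *m v = v -> A + P *m A *m P = v *m w ->
  (neg_proj P *m A <= pos_proj P)%MS.
Proof.
move=> PP Pv APA; apply: sub_pos_proj.
have: neg_proj P *m (A + P *m A *m P) = 0.
  by rewrite APA mulmxA neg_proj_fixed ?mul0mx.
rewrite mulmxDr !mulmxA neg_projP // !mulNmx => /eqP.
by rewrite subr_eq0 => /eqP.
Qed.

(** The singularity argument: [v] plays the part of the all-ones vector, here
any nonzero fixed vector of [P] that is an eigenvector of [A]. *)
Lemma det_eigenswap P A (v : 'cV[F]_n) (w : 'rV[F]_n) (mu : F) :
    P *m P = 1%:M -> \tr P = 0 -> P *m v = v -> v != 0 ->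
    A *m v = mu *: v -> A + P *m A *m P = v *m w ->
  \det A = 0.
Proof.
move=> PP trP Pv v0 Av APA; apply/eqP; apply: contraNT v0 => detA.
have unitA : A \in unitmx by rewrite unitmxE unitfE.
have rankNA : \rank (neg_proj P *m A) = \rank (pos_proj P).
  by rewrite mxrankMfree ?row_free_unit // rank_neg_proj.
(* Invertibility of [A] turns the inclusion of eigenspaces into an equality. *)
have posN : (pos_proj P <= neg_proj P *m A)%MS.
  have sub := eigenswap PP Pv APA.
  by rewrite -(geq_leqif (mxrank_leqif_sup sub)) rankNA.
case/submxP: posN => D posE.
rewrite -(pos_proj_fixed Pv) posE -!mulmxA Av -scalemxAr.
by rewrite neg_proj_fixed // scaler0 mulmx0.
Qed.

End Involution.

Lemma perm_mx_sym_involution (R : pzRingType) (n : nat) (P : 'M[R]_n) :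
  is_perm_mx P -> P^T = P -> P *m P = 1%:M.
Proof.
case/is_perm_mxP=> s -> symP.
by rewrite -[X in _ *m X]symP tr_perm_mx -perm_mxM mulgV perm_mx1.
Qed.

Lemma perm_mx_ones (R : realType) (n : nat) (P : 'M[R]_n) :
  is_perm_mx P -> P *m onesvec R n = onesvec R n.
Proof.
case/is_perm_mxP=> s ->; rewrite -row_permE.
by apply/matrixP=> i j; rewrite !mxE.
Qed.

Lemma magic_square_ones (R : realType) (n : nat) (mu : R) (A : 'M[R]_n) :
  magic_square mu A -> A *m onesvec R n = mu *: onesvec R n.
Proof.
case=> rowA _ _ _; apply/matrixP=> i j; rewrite ord1.
have := rowA i; rewrite /stdvec trmx_delta -rowE -row_mul mxE => ->.
by rewrite !mxE mulr1.
Qed.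

Theorem theorem12 (R : realType) (n : nat) (n_gt0 : (0 < n)%N)
    (n_even : ~~ odd n) (A : 'M[R]_n) (typeA : type_A_magic_square A) :
  \det A = 0.
Proof.
have [mu [magicA [P [[permP symP trP _] APA]]]] := typeA.
have ones_neq0 : onesvec R n != 0.
  apply/eqP=> /matrixP/(_ (Ordinal n_gt0) 0)/eqP.
  by rewrite !mxE oner_eq0.
apply: (det_eigenswap (perm_mx_sym_involution permP symP) (trP n_even)
  (perm_mx_ones permP) ones_neq0 (magic_square_ones magicA)).
by rewrite APA /onesmx scalemxAr.
Qed.
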